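(* Let $(M,\omega_\alpha,\mathcal F,J_\alpha,g)$, $\alpha\in\{1,\dots,k\}$, be a $k$-Kähler manifold (with transversal distribution $Q$). If the Levi-Civita connection $\nabla^g$ of $g$ preserves the distributions $L_\alpha$ for all $\alpha\in\{1,\dots,k\}$, then it also preserves $Q$, and it coincides with the canonical connection $\nabla$ of $(M,\omega_\alpha,\mathcal F,Q)$.
   Context: All objects are smooth; $\Gamma(E)$ denotes the sections of a bundle $E$. A connection preserves a distribution $D$ if $\nabla_V W\in\Gamma(D)$ for all $V\in\Gamma(TM)$, $W\in\Gamma(D)$. $k$-symplectic manifolds. For a $2$-form $\omega$ put $C_x(\omega)=\{v\in T_xM:\omega_x(v,w)=0 \text{ for all } w\in T_xM\}$. A $k$-symplectic manifold $(M,\omega_\alpha,\mathcal F)$ is a manifold $M$ of dimension $n(k+1)$ with $k$ closed $2$-forms $\omega_1,\dots,\omega_k$ and an $nk$-dimensional foliation $\mathcal F$ such that $\bigcap_\alpha C_x(\omega_\alpha)=\{0\}$ for all $x$, and $\omega_\alpha(X,X')=0$ for all $X,X'\in\Gamma(T\mathcal F)$ and all $\alpha$. Put $L=T\mathcal F$ and $L_{\alpha,x}=\bigcap_{\beta\neq\alpha}C_x(\omega_\beta)$ (with $L_1=L$ if $k=1$). Known facts: each $L_\alpha$ is an integrable distribution, $L=L_1\oplus\cdots\oplus L_k$, and $X\mapsto \omega_\alpha(X,\cdot)$ is an isomorphism $L_\alpha\to(TM/L)^\ast$. Transversal distribution. $Q$ is an $n$-dimensional integrable distribution with $TM=L\oplus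 Q$ such that: (i) $\omega_\alpha(Y,Y')=0$ for $Y,Y'\in\Gamma(Q)$ and all $\alpha$; (ii) $[X,Y]\in\Gamma(L_\alpha\oplus Q)$ for $X\in\Gamma(L_\alpha)$, $Y\in\Gamma(Q)$ and all $\alpha$; (iii) for all $Y,Y'\in\Gamma(Q)$ one has $(i_1^\ast)^{-1}(\psi_1^{YY'})=\cdots=(i_k^\ast)^{-1}(\psi_k^{YY'})$. Here $L_\alpha^\ast$ is identified with $\mathrm{ann}(\bigoplus_{\beta\ne\alpha}L_\beta\oplus Q)$, $i_\alpha^\ast:Q\to L_\alpha^\ast$ is the isomorphism $i_\alpha^\ast(Y)(X)=\omega_\alpha(Y,X)$, and $\psi_\alpha^{YY'}$ is the section $V\mapsto Y(\omega_\alpha(Y',V))-\omega_\alpha(Y',[Y,V])$ of $L_\alpha^\ast$. Canonical connection. Under these assumptions there is a unique connection $\nabla$ on $M$ which preserves all $L_\alpha$ and $Q$, satisfies $\nabla\omega_\alpha=0$ for all $\alpha$, and has torsion $T$ with $T(X,Y)=0$ for $X\in\Gamma(L)$, $Y\in\Gamma(Q)$. It is called the canonical connection. Compatible structures. A compatible almost $k$-Kähler structure $(J_1,\dots,J_k,g)$ consists of a Riemannian metric $g$ for which $L_1,\dots,L_k,Q$ are mutually orthogonal and endomorphisms $J_\alpha$ of $TM$ such that: $J_\alpha=0$ on $L_\beta$ for $\beta\ne\alpha$, with $L_\alpha=\bigcap_{\beta\ne\alpha}\ker J_\beta$ (for $k\geq 2$); $J_\alpha^2=-I$ on $L_\alpha\oplus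 Q$, $J_\alpha L_\alpha=Q$, $J_\alpha Q=L_\alpha$; and $\omega_\alpha(X,Y)=g(X,J_\alpha Y)$ for all $X,Y\in\Gamma(TM)$. Consequently $g(J_\alpha X,J_\alpha Y)=g(X,Y)$ for $X,Y\in\Gamma(L_\alpha\oplus Q)$, and the leaves of the foliation defined by the integrable distribution $L_\alpha\oplus Q$ are almost Kähler manifolds with the induced structure. $(M,\omega_\alpha,\mathcal F,J_\alpha,g)$ is called a $k$-Kähler manifold if for every $\alpha$ one has $[J_\alpha,J_\alpha]=0$ (vanishing Nijenhuis tensor along the leaves of $L_\alpha\oplus Q$), that is, if for every $\alpha$ all leaves of the foliation $L_\alpha\oplus Q$ are Kähler manifolds with the induced structure. *)

(* Defs.v *)
From HB Require Import structures.
From mathcomp Require Import all_boot all_order all_algebra.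
From mathcomp Require Import all_classical all_reals all_analysis.
From mathcomp Require Import ring.

Set Implicit Arguments.
Unset Strict Implicit.
Unset Printing Implicit Defensive.

Import Order.TTheory GRing.Theory Num.Theory.
Import numFieldNormedType.Exports.
Local Open Scope classical_set_scope.
Local Open Scope ring_scope.

(* * C^oo functions on open subsets of R^m *)

Section Euclidean.
Context {R : realType} {m : nat}.
Implicit Types (U : set 'rV[R]_m) (f g : 'rV[R]_m -> R).

(* All iterated partial derivatives up to order r exist and are continuous
   on U; only meant for open U. *)
Fixpoint Ck_on (r : nat) U f : Prop :=
  (forall p, U p -> {for p, continuous f}) /\
  if r is r'.+1 then
    forall i : 'I_m,
      (forall p, U p -> derivable f p (delta_mx 0 i)) /\
      Ck_on r' U ('D_(delta_mx 0 i) f)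
  else True.

Definition Coo_on U f : Prop := forall r, Ck_on r U f.

Lemma Ck_on_cont r U f : Ck_on r U f ->
  forall p, U p -> {for p, continuous f}.
Proof. by case: r => [|r] []. Qed.

Lemma Ck_onS r U f : Ck_on r.+1 U f -> Ck_on r U f.
Proof.
elim: r f => [|r IH] f [fc fd]; first by split.
by split=> // i; have [fdi /IH] := fd i; split.
Qed.

Lemma Ck_on_sub r U U' f : U' `<=` U -> Ck_on r U f -> Ck_on r U' f.
Proof.
move=> sU; elim: r f => [|r IH] f [fc fd].
  by split=> // p /sU; exact: fc.
split=> [p /sU|i]; first exact: fc.
by have [fdi fdr] := fd i; split=> [p /sU|]; [exact: fdi|exact: IH].
Qed.

Lemma near_on U f g p : open U -> U p -> (forall q, U q -> f q = g q) ->
  \near p, f p = g p.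
Proof. by move=> oU Up fg; apply: (filterS fg); exact: open_nbhs_nbhs. Qed.

Lemma continuous_at_on U f g p : open U -> U p -> (forall q, U q -> f q = g q) ->
  {for p, continuous f} -> {for p, continuous g}.
Proof.
move=> oU Up fg fc; rewrite /prop_for /continuous_at -(fg _ Up).
by apply: cvg_trans fc; apply: (@near_eq_cvg _ _ (nbhs p)); exact: near_on Up fg.
Qed.

Lemma Ck_on_eq r U f g : open U -> (forall p, U p -> f p = g p) ->
  Ck_on r U f -> Ck_on r U g.
Proof.
move=> oU; elim: r f g => [|r IH] f g fg [fc fd].
  by split=> // p Up; exact: continuous_at_on Up fg (fc p Up).
split=> [p Up|i]; first exact: continuous_at_on Up fg (fc p Up).
have [fdi fdr] := fd i; split=> [p Up|].
  by apply: near_eq_derivable (fdi p Up); exact: near_on Up fg.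
apply: IH fdr => p Up; apply: near_eq_derive; exact: near_on Up fg.
Qed.

Lemma Ck_on_cst r U a : Ck_on r U (fun=> a).
Proof.
elim: r a => [|r IH] a; first by split=> // p _; exact: cst_continuous.
split=> [p _|i]; first exact: cst_continuous.
split=> [p _|]; first exact: derivable_cst.
suff -> : 'D_(delta_mx 0 i) (fun=> a : R) = (fun=> 0) :> ('rV[R]_m -> R).
  exact: IH.
by apply/funext => p; exact: derive_cst.
Qed.

Lemma Ck_onD r U f g : open U -> Ck_on r U f -> Ck_on r U g ->
  Ck_on r U (fun p => f p + g p).
Proof.
move=> oU; elim: r f g => [|r IH] f g [fc fd] [gc gd].
  by split=> // p Up; apply: continuousD; [exact: fc|exact: gc].
split=> [p Up|i]; first by apply: continuousD; [exact: fc|exact: gc].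
have [fdi fdr] := fd i; have [gdi gdr] := gd i.
split=> [p Up|]; first by apply: derivableD; [exact: fdi|exact: gdi].
apply: (Ck_on_eq oU _ (IH _ _ fdr gdr)) => p Up.
by rewrite -deriveD //; [exact: fdi|exact: gdi].
Qed.

Lemma Ck_onM r U f g : open U -> Ck_on r U f -> Ck_on r U g ->
  Ck_on r U (fun p => f p * g p).
Proof.
move=> oU; elim: r f g => [|r IH] f g Hf Hg.
all: have fc := Ck_on_cont Hf; have gc := Ck_on_cont Hg.
  by split=> // p Up; apply: continuousM; [exact: fc|exact: gc].
have [_ fd] := Hf; have [_ gd] := Hg.
split=> [p Up|i]; first by apply: continuousM; [exact: fc|exact: gc].
have [fdi fdr] := fd i; have [gdi gdr] := gd i.
split=> [p Up|]; first by apply: derivableM; [exact: fdi|exact: gdi].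
have H := Ck_onD oU (IH _ _ (Ck_onS Hf) gdr) (IH _ _ (Ck_onS Hg) fdr).
apply: (Ck_on_eq oU _ H) => p Up.
by rewrite -[RHS]/('D_(delta_mx 0 i) (f * g) p) deriveM //;
  [exact: fdi|exact: gdi].
Qed.

End Euclidean.

(* * Smooth manifolds *)

Record chart (R : realType) (m : nat) (T : topologicalType) := Chart {
  cdom : set T;
  crange : set 'rV[R]_m;
  cmap : T -> 'rV[R]_m;
  cinv : 'rV[R]_m -> T;
  cdom_open : open cdom;
  crange_open : open crange;
  cmap_crange : forall x, cdom x -> crange (cmap x);
  cinv_cdom : forall p, crange p -> cdom (cinv p);
  cmapK : forall x, cdom x -> cinv (cmap x) = x;
  cinvK : forall p, crange p -> cmap (cinv p) = p;
  cmap_continuous : forall x, cdom x -> {for x, continuous cmap};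
  cinv_continuous : forall p, crange p -> {for p, continuous cinv} }.

Definition smooth_transition R m T (c c' : chart R m T) : Prop :=
  forall j : 'I_m,
    Coo_on (crange c `&` cinv c @^-1` cdom c')
           (fun p => cmap c' (cinv c p) 0 j).

Definition compatible R m T (c c' : chart R m T) : Prop :=
  smooth_transition c c' /\ smooth_transition c' c.

Record smooth_manifold (R : realType) (m : nat) := SmoothManifold {
  carrier :> topologicalType;
  atlas : set (chart R m carrier);
  manifold_hausdorff : hausdorff_space carrier;
  manifold_second_countable : @second_countable carrier;
  atlas_cover : forall x : carrier, exists2 c, atlas c & cdom c x;
  atlas_compatible : forall c c', atlas c -> atlas c' -> compatible c c' }.

Section Manifold.
Context {R : realType} {m : nat} {M : smooth_manifold R m}.
Implicit Types (W : set M) (f g h : M -> R) (x y z : M).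

(* Member of the maximal atlas. *)
Definition smooth_chart (c : chart R m M) : Prop :=
  forall c', atlas c' -> compatible c c'.

Definition smooth_on W f : Prop :=
  forall c : chart R m M, atlas c ->
    Coo_on (crange c `&` cinv c @^-1` W) (f \o cinv c).

(* Smooth on some neighbourhood of x. *)
Definition smooth_at x f : Prop :=
  exists W : set M, [/\ open W, W x & smooth_on W f].

Lemma chart_preimage_open (c : chart R m M) W :
  open W -> open (crange c `&` cinv c @^-1` W).
Proof.
move=> oW; rewrite openE => p [cp Wp].
have : nbhs (cinv c p) W by exact: open_nbhs_nbhs.
move=> /(cinv_continuous cp) nW.
apply: filterI => //; apply: open_nbhs_nbhs; split=> //.
exact: crange_open.
Qed.

Lemma smooth_on_sub W W' f : W' `<=` W -> smooth_on W f -> smooth_on W' f.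
Proof. by move=> sW Hf c ac r; apply: Ck_on_sub (Hf c ac r) => p [cp /sW]. Qed.

Lemma smooth_at_near x f : smooth_at x f ->
  exists W : set M, [/\ open W, W x & forall y, W y -> smooth_at y f].
Proof. by move=> [W [oW Wx Hf]]; exists W; split=> // y Wy; exists W. Qed.

Lemma smooth_at_eq x f g W : open W -> W x -> (forall y, W y -> f y = g y) ->
  smooth_at x f -> smooth_at x g.
Proof.
move=> oW Wx fg [W' [oW' W'x Hf]]; exists (W `&` W').
have oI : open (W `&` W') by exact: openI.
split=> // c ac r.
apply: (@Ck_on_eq _ _ _ _ (f \o cinv c)).
- exact: chart_preimage_open.
- by move=> p [_ [Wp _]] /=; exact: fg.
- by apply: Ck_on_sub (Hf c ac r) => p [cp [_ Wp]].
Qed.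

Lemma smooth_at_cst x a : smooth_at x (fun=> a).
Proof.
by exists setT; split=> //; [exact: openT|move=> c ac r; exact: Ck_on_cst].
Qed.

Lemma smooth_at_op2 (op : R -> R -> R) x f g :
  (forall r (U : set 'rV[R]_m) u v, open U -> Ck_on r U u -> Ck_on r U v ->
     Ck_on r U (fun p => op (u p) (v p))) ->
  smooth_at x f -> smooth_at x g -> smooth_at x (fun y => op (f y) (g y)).
Proof.
move=> Hop [W [oW Wx Hf]] [W' [oW' W'x Hg]]; exists (W `&` W').
have oI : open (W `&` W') by exact: openI.
split=> // c ac r; apply: Hop; first exact: chart_preimage_open.
- by apply: (smooth_on_sub _ Hf) => // y [].
- by apply: (smooth_on_sub _ Hg) => // y [].
Qed.

Lemma smooth_atD x f g : smooth_at x f -> smooth_at x g ->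
  smooth_at x (fun y => f y + g y).
Proof. by apply: smooth_at_op2 => r U u v; exact: Ck_onD. Qed.

Lemma smooth_atM x f g : smooth_at x f -> smooth_at x g ->
  smooth_at x (fun y => f y * g y).
Proof. by apply: smooth_at_op2 => r U u v; exact: Ck_onM. Qed.

Lemma smooth_atZD a x f g : smooth_at x f -> smooth_at x g ->
  smooth_at x (fun y => a * f y + g y).
Proof.
move=> sf sg; apply: smooth_atD => //; apply: smooth_atM => //.
exact: smooth_at_cst.
Qed.

Lemma smooth_atB x f g : smooth_at x f -> smooth_at x g ->
  smooth_at x (fun y => f y - g y).
Proof.
move=> sf sg; have -> : (fun y => f y - g y) = (fun y => -1 * g y + f y).
  by apply/funext => y; ring.
exact: smooth_atZD.
Qed.

(* ** Tangent vectors *)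

(* T_x M is the space of derivations at x of the functions that are smooth
   near x.  Such a derivation only depends on germs (lemma tangent_local).
   The value at functions that are not smooth near x is pinned to 0, so that
   equality of derivations is equality of functions. *)
Definition is_derivation x (v : (M -> R) -> R^o) : Prop :=
  [/\ forall f, ~ smooth_at x f -> v f = 0,
      forall a f g, smooth_at x f -> smooth_at x g ->
        v (fun y => a * f y + g y) = a * v f + v g &
      forall f g, smooth_at x f -> smooth_at x g ->
        v (fun y => f y * g y) = v f * g x + f x * v g].

Definition derivation_pred x : {pred ((M -> R) -> R^o)} :=
  fun v => `[< is_derivation x v >].

Lemma derivation_submod x : submod_closed (derivation_pred x).
Proof.
split.
  apply/asboolP; split=> // [a f g _ _|f g _ _] /=.
    by rewrite mulr0 addr0.
  by rewrite mul0r mulr0 addr0.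
move=> a u v /asboolP[u0 uD uM] /asboolP[v0 vD vM]; apply/asboolP.
have E f : (a *: u + v) f = a * u f + v f by [].
split=> [f nf|b f g sf sg|f g sf sg]; rewrite !E.
- by rewrite u0 // v0 // mulr0 addr0.
- by rewrite uD // vD //; ring.
- by rewrite uM // vM //; ring.
Qed.

HB.instance Definition _ x := GRing.isSubmodClosed.Build R
  ((M -> R) -> R^o) (derivation_pred x) (derivation_submod x).

Record tangent x := Tangent {
  tangent_act :> (M -> R) -> R^o;
  tangentP : tangent_act \in derivation_pred x }.

HB.instance Definition _ x := [isSub for @tangent_act x].
HB.instance Definition _ x := [Choice of tangent x by <:].
HB.instance Definition _ x := [SubChoice_isSubLmodule of tangent x by <:].

Lemma tangent_ext x (u v : tangent x) :
  (forall f, smooth_at x f -> u f = v f) -> u = v.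
Proof.
move=> uv; apply: val_inj; apply/funext => f /=.
have [sf|nf] := pselect (smooth_at x f); first exact: uv.
have /asboolP[u0 _ _] := tangentP u; have /asboolP[v0 _ _] := tangentP v.
by rewrite u0 // v0.
Qed.

Lemma tangentDE x (u v : tangent x) f : (u + v) f = u f + v f.
Proof. by []. Qed.

Lemma tangentZE x a (v : tangent x) f : (a *: v) f = a * v f.
Proof. by []. Qed.

Lemma tangent_lin x (v : tangent x) a f g : smooth_at x f -> smooth_at x g ->
  v (fun y => a * f y + g y) = a * v f + v g.
Proof. by have /asboolP[_ H _] := tangentP v; exact: H. Qed.

Lemma tangent_leibniz x (v : tangent x) f g :
  smooth_at x f -> smooth_at x g ->
  v (fun y => f y * g y) = v f * g x + f x * v g.
Proof. by have /asboolP[_ _ H] := tangentP v; exact: H. Qed.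

Lemma tangentD x (v : tangent x) f g : smooth_at x f -> smooth_at x g ->
  v (fun y => f y + g y) = v f + v g.
Proof.
move=> sf sg; rewrite -[v f]mul1r -tangent_lin //; congr (v _).
by apply/funext => y; rewrite mul1r.
Qed.

Lemma tangent_local x (v : tangent x) f g W : open W -> W x ->
  (forall y, W y -> f y = g y) -> v f = v g.
Proof.
move=> oW Wx fg.
have [sf|nf] := pselect (smooth_at x f); last first.
  have ng : ~ smooth_at x g.
    by move=> sg; apply/nf/(smooth_at_eq oW Wx _ sg) => y /fg.
  by have /asboolP[v0 _ _] := tangentP v; rewrite !v0.
have sg := smooth_at_eq oW Wx fg sf.
pose chi y : R := if `[< W y >] then 0 else 1.
have chi0 y : W y -> chi y = 0 by rewrite /chi => /asboolT ->.
have schi : smooth_at x chi.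
  by apply: (smooth_at_eq oW Wx _ (smooth_at_cst x 0)) => y /chi0.
have sB := smooth_atB sf sg.
have v0 : v (fun y => f y - g y) = 0.
  have -> : (fun y => f y - g y) = (fun y => (f y - g y) * chi y).
    apply/funext => y; rewrite /chi; case: asboolP => [/fg ->|_].
      by rewrite subrr mul0r.
    by rewrite mulr1.
  by rewrite tangent_leibniz // chi0 // fg // subrr mulr0 mul0r addr0.
have -> : f = (fun y => (f y - g y) + g y).
  by apply/funext => y; rewrite subrK.
by rewrite tangentD // v0 add0r.
Qed.

(* ** Vector fields *)

(* Smoothness near x of a section of TM which may be rough elsewhere. *)
Definition smooth_section_at x (X : forall y, tangent y) : Prop :=
  forall f, smooth_at x f -> smooth_at x (fun y => X y f).

Record vector_field := VectorField {
  vf_section :> forall x, tangent x;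
  vf_smooth : forall x, smooth_section_at x vf_section }.

Implicit Types (X Y Z V : vector_field).

Lemma vector_field_ext X Y : (forall x, X x = Y x) -> X = Y.
Proof.
case: X Y => [X sX] [Y sY] /= XY.
have E : X = Y by exact: functional_extensionality_dep.
by rewrite {}E in sX *; congr VectorField; exact: Prop_irrelevance.
Qed.

Lemma vf_add_smooth X Y x : smooth_section_at x (fun y => X y + Y y).
Proof. by move=> f sf; apply: smooth_atD; exact: vf_smooth. Qed.

Definition vf_add X Y := VectorField (vf_add_smooth X Y).

Record smooth_function := SmoothFunction {
  sf_fun :> M -> R;
  sf_smooth : forall x, smooth_at x sf_fun }.

Lemma vf_scale_smooth (f : smooth_function) X x :
  smooth_section_at x (fun y => f y *: X y).
Proof.
by move=> h sh; apply: smooth_atM; [exact: sf_smooth|exact: vf_smooth].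
Qed.

Definition vf_scale (f : smooth_function) X :=
  VectorField (vf_scale_smooth f X).

Definition bracket_act X Y x : (M -> R) -> R^o := fun f =>
  if `[< smooth_at x f >] then
    X x (fun y => Y y f) - Y x (fun y => X y f)
  else 0.

Lemma bracket_actE X Y x f : smooth_at x f ->
  bracket_act X Y x f = X x (fun y => Y y f) - Y x (fun y => X y f).
Proof. by rewrite /bracket_act => /asboolT ->. Qed.

Lemma vf_vf_lin X Y x a f g : smooth_at x f -> smooth_at x g ->
  X x (fun y => Y y (fun z => a * f z + g z)) =
  a * X x (fun y => Y y f) + X x (fun y => Y y g).
Proof.
move=> sf sg.
have [W [oW Wx Wf]] := smooth_at_near sf.
have [W' [oW' Wx' Wg]] := smooth_at_near sg.
rewrite -tangent_lin; [|exact: vf_smooth..].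
apply: (@tangent_local _ _ _ _ (W `&` W')) => // [|y [Wy W'y]].
  exact: openI.
by rewrite tangent_lin //; [exact: Wf|exact: Wg].
Qed.

Lemma vf_vf_leibniz X Y x f g : smooth_at x f -> smooth_at x g ->
  X x (fun y => Y y (fun z => f z * g z)) =
  X x (fun y => Y y f) * g x + Y x f * X x g +
  (X x f * Y x g + f x * X x (fun y => Y y g)).
Proof.
move=> sf sg.
have [W [oW Wx Wf]] := smooth_at_near sf.
have [W' [oW' Wx' Wg]] := smooth_at_near sg.
have sYf := vf_smooth Y sf; have sYg := vf_smooth Y sg.
rewrite -!tangent_leibniz // -tangentD; [|exact: smooth_atM..].
apply: (@tangent_local _ _ _ _ (W `&` W')) => // [|y [Wy W'y]].
  exact: openI.
by rewrite tangent_leibniz //; [exact: Wf|exact: Wg].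
Qed.

Lemma bracket_derivation X Y x : bracket_act X Y x \in derivation_pred x.
Proof.
apply/asboolP; split.
- by move=> f nf; rewrite /bracket_act asboolF.
- move=> a f g sf sg; rewrite !bracket_actE //; last exact: smooth_atZD.
  by rewrite !vf_vf_lin //; ring.
- move=> f g sf sg; rewrite !bracket_actE //; last exact: smooth_atM.
  by rewrite !vf_vf_leibniz //; ring.
Qed.

Lemma bracket_smooth X Y x :
  smooth_section_at x (fun y => Tangent (bracket_derivation X Y y)).
Proof.
move=> f sf.
have [W [oW Wx Wf]] := smooth_at_near sf.
have H : smooth_at x
    (fun y => X y (fun z => Y z f) - Y y (fun z => X z f)).
  by apply: smooth_atB; do 2!apply: vf_smooth.
apply: (smooth_at_eq oW Wx _ H) => y Wy /=.
by rewrite bracket_actE //; exact: Wf.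
Qed.

Definition bracket X Y := VectorField (bracket_smooth X Y).

(* ** Tensor fields *)

Record bilinear_field := BilinearField {
  bil :> forall x, tangent x -> tangent x -> R;
  bil_linear_l : forall x (v : tangent x), scalar (fun u => bil u v);
  bil_linear_r : forall x (u : tangent x), scalar (bil u);
  bil_smooth : forall x (X Y : forall y, tangent y),
    smooth_section_at x X -> smooth_section_at x Y ->
    smooth_at x (fun y => bil (X y) (Y y)) }.

Arguments bil b x u v : rename, clear implicits.

Record endo_field := EndoField {
  endo :> forall x, tangent x -> tangent x;
  endo_linear : forall x, linear (@endo x);
  endo_smooth : forall x (X : forall y, tangent y),
    smooth_section_at x X -> smooth_section_at x (fun y => endo (X y)) }.

Arguments endo J x v : rename, clear implicits.

Definition endo_app (J : endo_field) X : vector_field :=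
  VectorField (fun x => endo_smooth J (vf_smooth X (x := x))).

Definition two_form (w : bilinear_field) : Prop :=
  forall x (v : tangent x), w x v v = 0.

(* The value at x of d w (X, Y, Z). *)
Definition ext_deriv2 (w : bilinear_field) X Y Z x : R :=
  X x (fun y => w y (Y y) (Z y)) - Y x (fun y => w y (X y) (Z y))
  + Z x (fun y => w y (X y) (Y y))
  - w x (bracket X Y x) (Z x) + w x (bracket X Z x) (Y x)
  - w x (bracket Y Z x) (X x).

Definition closed_form (w : bilinear_field) : Prop :=
  forall X Y Z x, ext_deriv2 w X Y Z x = 0.

Definition riemannian_metric (g : bilinear_field) : Prop :=
  (forall x (u v : tangent x), g x u v = g x v u) /\
  (forall x (v : tangent x), v != 0 -> 0 < g x v v).

Definition char_space (w : bilinear_field) x : set (tangent x) :=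
  [set v | forall u, w x v u = 0].

Arguments char_space : clear implicits.

Definition nijenhuis (J : endo_field) X Y x : tangent x :=
  bracket (endo_app J X) (endo_app J Y) x
  - J x (bracket (endo_app J X) Y x) - J x (bracket X (endo_app J Y) x)
  + J x (J x (bracket X Y x)).

(* ** Distributions *)

Definition subspace_field := forall x, set (tangent x).
Implicit Types (D : subspace_field).

Definition section_of D X : Prop := forall x, D x (X x).

Definition dsum D D' : subspace_field :=
  fun x => [set u + v | u in D x & v in D' x].

Arguments dsum : clear implicits.

Definition complementary D D' : Prop :=
  forall x, D x `&` D' x = [set 0] /\ dsum D D' x = setT.

(* Smooth subbundle of rank d, given by smooth local frames. *)
Definition distribution (d : nat) D : Prop :=
  forall x, exists (W : set M) (e : 'I_d -> forall y, tangent y),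
    [/\ open W, W x,
        forall i y, W y -> smooth_section_at y (e i),
        forall y (a : 'I_d -> R), W y ->
          \sum_i a i *: e i y = 0 -> forall i, a i = 0 &
        forall y, W y ->
          D y = [set v | exists a : 'I_d -> R, v = \sum_i a i *: e i y]].

(* Every point has a foliated chart: in its domain, the last m - d coordinates
   are constant along the leaves and their differentials cut out D.  Hence D is
   the tangent distribution of a d-dimensional foliation. *)
Definition integrable_distribution (d : nat) D : Prop :=
  distribution d D /\
  forall x, exists c : chart R m M,
    [/\ smooth_chart c, cdom c x &
        forall y, cdom c y ->
          D y = [set v | forall j : 'I_m, (d <= j)%N ->
                           v (fun z => cmap c z 0 j) = 0]].

(* ** Connections *)

Record connection := Connection {
  nabla :> vector_field -> vector_field -> vector_field;
  nablaDl : forall X X' Y,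
    nabla (vf_add X X') Y = vf_add (nabla X Y) (nabla X' Y);
  nablaZl : forall (f : smooth_function) X Y,
    nabla (vf_scale f X) Y = vf_scale f (nabla X Y);
  nablaDr : forall X Y Y',
    nabla X (vf_add Y Y') = vf_add (nabla X Y) (nabla X Y');
  nabla_leibniz : forall (f : smooth_function) X Y x,
    nabla X (vf_scale f Y) x = X x f *: Y x + f x *: nabla X Y x }.

Definition preserves (N : connection) D : Prop :=
  forall V W : vector_field, section_of D W -> section_of D (N V W).

Definition parallel (N : connection) (b : bilinear_field) : Prop :=
  forall V X Y x,
    V x (fun y => b y (X y) (Y y)) =
    b x (N V X x) (Y x) + b x (X x) (N V Y x).

Definition torsion (N : connection) X Y x : tangent x :=
  N X Y x - N Y X x - bracket X Y x.

Definition levi_civita (g : bilinear_field) (N : connection) : Prop :=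
  parallel N g /\ forall X Y x, torsion N X Y x = 0.

End Manifold.

Arguments vector_field {R m} M.
Arguments bilinear_field {R m} M.
Arguments endo_field {R m} M.
Arguments subspace_field {R m} M.
Arguments connection {R m} M.
Arguments bil {R m M} b x u v : rename.
Arguments endo {R m M} J x v : rename.
Arguments char_space {R m M} w x _.
Arguments dsum {R m M} D D' x _.

(* * k-symplectic and k-Kaehler manifolds *)

Section KSymplectic.
Context {R : realType} {n k : nat} {M : smooth_manifold R (n * k.+1)}.
Implicit Types (w : 'I_k -> bilinear_field M) (L Q : subspace_field M).
Implicit Types (J : 'I_k -> endo_field M) (g : bilinear_field M).

(* The foliation enters through its tangent distribution L. *)
Definition k_symplectic w L : Prop :=
  [/\ forall a, two_form (w a) /\ closed_form (w a),
      integrable_distribution (n * k) L,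
      forall x, \bigcap_(a in [set: 'I_k]) char_space (w a) x = [set 0] &
      forall a x (u v : tangent x), L x u -> L x v -> w a x u v = 0].

Definition Lsub w L (a : 'I_k) : subspace_field M := fun x =>
  if k == 1%N then L x
  else \bigcap_(b in [set b | b != a]) char_space (w b) x.

Arguments Lsub : clear implicits.

(* The section psi_a^{Y Y'} of L_a^*, evaluated on V in Gamma(L_a). *)
Definition psi w (a : 'I_k) (Y Y' V : vector_field M) (x : M) : R :=
  Y x (fun y => w a y (Y' y) (V y)) - w a x (Y' x) (bracket Y V x).

(* Z in Gamma(Q) and i_a^* Z = psi_a^{Y Y'} as sections of L_a^*, where
   i_a^* sends Z to V |-> w_a (Z, V). *)
Definition psi_preimage w L Q (a : 'I_k) (Y Y' Z : vector_field M) : Prop :=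
  section_of Q Z /\
  forall V, section_of (Lsub w L a) V ->
    forall x, w a x (Z x) (V x) = psi w a Y Y' V x.

(* As each i_a^* is an isomorphism Q -> L_a^*, the last clause says that
   the preimages of the psi_a^{Y Y'} all coincide. *)
Definition transversal w L Q : Prop :=
  [/\ integrable_distribution n Q /\ complementary L Q,
      forall a x (u v : tangent x), Q x u -> Q x v -> w a x u v = 0,
      forall a X Y, section_of (Lsub w L a) X -> section_of Q Y ->
        section_of (dsum (Lsub w L a) Q) (bracket X Y) &
      forall Y Y', section_of Q Y -> section_of Q Y' ->
        exists Z, forall a, psi_preimage w L Q a Y Y' Z].

Definition canonical_connection w L Q (N : connection M) : Prop :=
  [/\ forall a, preserves N (Lsub w L a),
      preserves N Q,
      forall a, parallel N (w a) &
      forall X Y, section_of L X -> section_of Q Y ->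
        forall x, torsion N X Y x = 0].

Definition orthogonal_fields g (D D' : subspace_field M) : Prop :=
  forall x (u v : tangent x), D x u -> D' x v -> g x u v = 0.

Record almost_k_kahler w L Q J g : Prop := AlmostKKahler {
  akk_metric : riemannian_metric g;
  akk_orthLL : forall a b, a != b ->
    orthogonal_fields g (Lsub w L a) (Lsub w L b);
  akk_orthLQ : forall a, orthogonal_fields g (Lsub w L a) Q;
  akk_J0 : forall a b, b != a -> forall x (v : tangent x),
    Lsub w L b x v -> J a x v = 0;
  akk_ker : (2 <= k)%N -> forall a x,
    Lsub w L a x = [set v | forall b, b != a -> J b x v = 0];
  akk_Jsq : forall a x (v : tangent x),
    dsum (Lsub w L a) Q x v -> J a x (J a x v) = - v;
  akk_JL : forall a x, J a x @` Lsub w L a x = Q x;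
  akk_JQ : forall a x, J a x @` Q x = Lsub w L a x;
  akk_compat : forall a x (u v : tangent x), w a x u v = g x u (J a x v) }.

Definition k_kahler w L Q J g : Prop :=
  [/\ k_symplectic w L, transversal w L Q, almost_k_kahler w L Q J g &
      forall a X Y,
        section_of (dsum (Lsub w L a) Q) X ->
        section_of (dsum (Lsub w L a) Q) Y ->
        forall x, nijenhuis (J a) X Y x = 0].

End KSymplectic.

Arguments Lsub {R n k M} w L a x _.

(* Main.v *)
Require Import Defs.
From mathcomp Require Import all_boot all_order all_algebra.
From mathcomp Require Import all_classical all_reals all_analysis.
From mathcomp Require Import ring lra.
From HB Require Import structures.

(* Write D(V, X, Y) = (nabla_V w_a)(X, Y) for the Levi-Civita connection.  TM is
   the orthogonal direct sum of ker J_a and im J_a = L_a + Q, and ker J_a is the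
   sum of the L_b, b <> a, hence is parallel: D vanishes when X or Y is in
   ker J_a.  On im J_a, the usual Kaehler computation (d w_a = 0 and the
   vanishing Nijenhuis tensor) gives D = 0, and for V in ker J_a and X, Y in
   im J_a, D(V, X, Y) is the only term left in d w_a(V, X, Y) = 0.  So w_a and
   J_a are parallel, and Q = J_a L_a is preserved.

   Uniqueness: for canonical connections, the vanishing mixed torsion and the
   splitting TM = L + Q determine nabla on mixed arguments, and then
   nabla w_a = 0 determines it on pairs in L and on pairs in Q.  Every
   vector field splits globally along L + Q because L and Q are orthogonal, so
   no local extension of tangent vectors is needed. *)

Set Implicit Arguments.
Unset Strict Implicit.
Unset Printing Implicit Defensive.

Import Order.TTheory GRing.Theory Num.Theory.
Import numFieldNormedType.Exports.

(** * Smoothness of reciprocals, determinants and adjugates *)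

Section SmoothAlgebra.
Local Open Scope classical_set_scope.
Local Open Scope ring_scope.

Lemma Ck_onV (R : realType) m r (U : set 'rV[R]_m) (f : 'rV[R]_m -> R) :
  open U -> (forall p, U p -> f p != 0) -> Ck_on r U f ->
  Ck_on r U (fun p => (f p)^-1).
Proof.
move=> oU f0; elim: r => [|r IH] Hf.
all: have fc := Ck_on_cont Hf.
  by split=> // p Up; apply: continuousV; [exact: f0|exact: fc].
have [_ fd] := Hf.
split=> [p Up|i]; first by apply: continuousV; [exact: f0|exact: fc].
have [fdi fdr] := fd i; split=> [p Up|].
  by apply: derivableV; [exact: f0|exact: fdi].
have HV := IH (Ck_onS Hf).
(* The product is -1 (1/f)(1/f) D_i f, the partial derivative of 1/f; the induction hypothesis
   supplies the regularity of 1/f one order lower. *)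
have H := Ck_onM oU (Ck_onM oU (Ck_on_cst r U (-1)) (Ck_onM oU HV HV)) fdr.
apply: (Ck_on_eq oU _ H) => p Up.
rewrite [RHS]deriveV; [|exact: f0|exact: fdi].
by rewrite /GRing.scale /= expr2 invfM mulN1r.
Qed.

Context {R : realType} {m : nat} {M : smooth_manifold R m}.
Implicit Types (x y : M) (W : set M).

Lemma smooth_at_inv x (f : M -> R) W : open W -> W x ->
  (forall y, W y -> f y != 0) -> smooth_at x f ->
  smooth_at x (fun y => (f y)^-1).
Proof.
move=> oW Wx f0 [W' [oW' W'x Hf]]; exists (W `&` W').
have oI : open (W `&` W') by exact: openI.
split=> // c ac r; apply: Ck_onV; first exact: chart_preimage_open.
- by move=> p [_ [Wp _]]; exact: f0.
- by apply: (smooth_on_sub _ Hf) => // y [].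
Qed.

Lemma smooth_at_sum x (I : Type) (s : seq I) (P : pred I) (F : I -> M -> R) :
  (forall i, smooth_at x (F i)) ->
  smooth_at x (fun y => \sum_(i <- s | P i) F i y).
Proof.
move=> sF; elim: s => [|i s IH].
  have -> : (fun y => \sum_(i <- [::] | P i) F i y) = (fun=> 0).
    by apply/funext => y; rewrite big_nil.
  exact: smooth_at_cst.
have -> : (fun y => \sum_(j <- i :: s | P j) F j y) =
    (fun y => (if P i then F i y else 0) + \sum_(j <- s | P j) F j y).
  by apply/funext => y; rewrite big_cons; case: ifP; rewrite ?add0r.
by apply: smooth_atD => //; case: (P i) => //; exact: smooth_at_cst.
Qed.

Lemma smooth_at_prod x (I : Type) (s : seq I) (P : pred I) (F : I -> M -> R) :
  (forall i, smooth_at x (F i)) ->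
  smooth_at x (fun y => \prod_(i <- s | P i) F i y).
Proof.
move=> sF; elim: s => [|i s IH].
  have -> : (fun y => \prod_(i <- [::] | P i) F i y) = (fun=> 1).
    by apply/funext => y; rewrite big_nil.
  exact: smooth_at_cst.
have -> : (fun y => \prod_(j <- i :: s | P j) F j y) =
    (fun y => (if P i then F i y else 1) * \prod_(j <- s | P j) F j y).
  by apply/funext => y; rewrite big_cons; case: ifP; rewrite ?mul1r.
by apply: smooth_atM => //; case: (P i) => //; exact: smooth_at_cst.
Qed.

Lemma smooth_at_det x d (A : M -> 'M[R]_d) :
  (forall i j, smooth_at x (fun y => A y i j)) ->
  smooth_at x (fun y => \det (A y)).
Proof.
move=> sA; apply: smooth_at_sum => s; apply: smooth_atM.
  exact: smooth_at_cst.
by apply: smooth_at_prod => i; exact: sA.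
Qed.

Lemma smooth_at_adj x d (A : M -> 'M[R]_d) :
  (forall i j, smooth_at x (fun y => A y i j)) ->
  forall i j, smooth_at x (fun y => (\adj (A y)) i j).
Proof.
move=> sA i j.
have -> : (fun y => (\adj (A y)) i j) =
    (fun y => (-1) ^+ (j + i) * \det (row' j (col' i (A y)))).
  by apply/funext => y; rewrite mxE.
apply: smooth_atM; first exact: smooth_at_cst.
apply: smooth_at_det => i' j'.
have -> : (fun y => row' j (col' i (A y)) i' j') =
    (fun y => A y (lift j i') (lift i j')).
  by apply/funext => y; rewrite !mxE.
exact: sA.
Qed.

End SmoothAlgebra.

(** * Tensors at a point and smooth orthogonal projections *)

Section TensorAlgebra.
Local Open Scope classical_set_scope.
Local Open Scope ring_scope.
Context {R : realType} {m : nat} {M : smooth_manifold R m}.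
Implicit Types (x y : M) (b g w : bilinear_field M) (J : endo_field M).
Implicit Types (D : subspace_field M).

Lemma bilDl b x (u u' v : tangent x) : b x (u + u') v = b x u v + b x u' v.
Proof. by have := bil_linear_l b v 1 u u'; rewrite scale1r mul1r. Qed.

Lemma bilDr b x (u v v' : tangent x) : b x u (v + v') = b x u v + b x u v'.
Proof. by have := bil_linear_r b u 1 v v'; rewrite scale1r mul1r. Qed.

Lemma bil0l b x (v : tangent x) : b x 0 v = 0.
Proof. by have := bilDl b 0 0 v; rewrite addr0; lra. Qed.

Lemma bil0r b x (u : tangent x) : b x u 0 = 0.
Proof. by have := bilDr b u 0 0; rewrite addr0; lra. Qed.

Lemma bilZl b x a (u v : tangent x) : b x (a *: u) v = a * b x u v.
Proof. by have := bil_linear_l b v a u 0; rewrite !addr0 bil0l addr0. Qed.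

Lemma bilNl b x (u v : tangent x) : b x (- u) v = - b x u v.
Proof. by rewrite -scaleN1r bilZl mulN1r. Qed.

Lemma bilZr b x a (u v : tangent x) : b x u (a *: v) = a * b x u v.
Proof. by have := bil_linear_r b u a v 0; rewrite !addr0 bil0r addr0. Qed.

Lemma bilNr b x (u v : tangent x) : b x u (- v) = - b x u v.
Proof. by have := bilDr b u v (- v); rewrite subrr bil0r; lra. Qed.

Lemma bil_suml b x d (F : 'I_d -> tangent x) (v : tangent x) :
  b x (\sum_i F i) v = \sum_i b x (F i) v.
Proof.
by apply: (big_morph (fun u => b x u v)) => [u u'|]; rewrite ?bilDl ?bil0l.
Qed.

Lemma bil_sumr b x d (F : 'I_d -> tangent x) (u : tangent x) :
  b x u (\sum_i F i) = \sum_i b x u (F i).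
Proof.
by apply: (big_morph (b x u)) => [v v'|]; rewrite ?bilDr ?bil0r.
Qed.

Lemma endoD J x (u v : tangent x) : J x (u + v) = J x u + J x v.
Proof. by have := endo_linear J 1 u v; rewrite !scale1r. Qed.

Lemma endo0 J x : J x 0 = 0.
Proof.
by apply: (addrI (J x 0)); rewrite -endoD !addr0.
Qed.

Lemma endoN J x (u : tangent x) : J x (- u) = - J x u.
Proof. by apply: (addrI (J x u)); rewrite -endoD !subrr endo0. Qed.

Lemma endo_sum J x (I : Type) (s : seq I) (P : pred I) (F : I -> tangent x) :
  J x (\sum_(i <- s | P i) F i) = \sum_(i <- s | P i) J x (F i).
Proof. by apply: big_morph; [exact: endoD|exact: endo0]. Qed.

Lemma tangent0 x (v : tangent x) : v (fun=> 0) = 0.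
Proof.
have := tangentD v (smooth_at_cst x 0) (smooth_at_cst x 0).
by rewrite addr0; lra.
Qed.

Lemma tangentN x (v : tangent x) f : smooth_at x f ->
  v (fun y => - f y) = - v f.
Proof.
move=> sf; have := tangent_lin v (-1) sf (smooth_at_cst x 0).
rewrite tangent0 mulN1r addr0 => <-; congr (v _).
by apply/funext => y; rewrite mulN1r addr0.
Qed.

Lemma tangent_sumE x d (F : 'I_d -> tangent x) f :
  (\sum_i F i) f = \sum_i F i f.
Proof. exact: (big_morph (fun u : tangent x => u f)). Qed.

Lemma metric_eq0 g x (v : tangent x) : riemannian_metric g ->
  g x v v = 0 -> v = 0.
Proof.
move=> [_ gpos] gv; apply/eqP/negPn/negP => /gpos.
by rewrite gv ltxx.
Qed.

(* In a local frame e of D, the coordinates of P X are the solution of a linear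
   system with the Gram matrix of e, hence smooth by Cramer's rule. *)
Lemma orth_proj_smooth d D g (P : forall y, tangent y -> tangent y) :
  Defs.distribution d D -> riemannian_metric g ->
  (forall y v, D y (P y v)) ->
  (forall y (u v : tangent y), D y u -> g y (v - P y v) u = 0) ->
  forall x (X : forall y, tangent y), smooth_section_at x X ->
    smooth_section_at x (fun y => P y (X y)).
Proof.
move=> dD gm PD Porth x X sX f sf.
have [W [e [oW Wx se free_e spanD]]] := dD x.
pose G y : 'M[R]_d := \matrix_(i, j) g y (e i y) (e j y).
have mulG y (a : 'rV_d) j :
    (a *m G y) 0 j = g y (\sum_i a 0 i *: e i y) (e j y).
  rewrite mxE bil_suml; apply: eq_bigr => i _.
  by rewrite bilZl mxE.
(* A row killed by the Gram matrix gives a combination of the frame orthogonal to each [e j], hence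
   to itself. *)
have det_neq0 y : W y -> \det (G y) != 0.
  move=> Wy; apply/negP => /det0P[a a0 aG].
  have u0 : \sum_i a 0 i *: e i y = 0.
    apply: (metric_eq0 gm); rewrite bil_sumr big1 // => j _.
    by rewrite bilZr -mulG aG mxE mulr0.
  case/negP: a0; apply/eqP/rowP => i; rewrite mxE.
  exact: (free_e y (fun i => a 0 i)).
pose c i y := (\det (G y))^-1 * \sum_j g y (X y) (e j y) * (\adj (G y)) j i.
have PE y : W y -> P y (X y) = \sum_i c i y *: e i y.
  move=> Wy; have := PD y (X y); rewrite (spanD _ Wy) => -[a aE].
  rewrite aE; apply: eq_bigr => i _; congr (_ *: _).
  (* Since X - P X is orthogonal to D, the row a of coordinates satisfies a G = (g(X, e_j))_j; the
     adjugate then isolates each entry of a. *)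
  have detE : (\row_i a i *m G y) *m \adj (G y) =
      \det (G y) *: (\row_i a i : 'rV_d).
    by rewrite -mulmxA mul_mx_adj mul_mx_scalar.
  move/rowP: detE => /(_ i); rewrite !mxE => detE.
  rewrite /c; apply: (mulfI (det_neq0 y Wy)); rewrite mulVKf ?det_neq0 //.
  rewrite -detE; apply: eq_bigr => j _; congr (_ * _).
  rewrite mulG; under eq_bigr do rewrite mxE.
  rewrite -aE; have eD : D y (e j y).
    rewrite (spanD _ Wy); exists (fun l => (l == j)%:R).
    rewrite (bigD1 j) //= eqxx scale1r big1 ?addr0 // => l /negPf ->.
    by rewrite scale0r.
  by have := Porth y _ (X y) eD; rewrite bilDl bilNl; lra.
have sg i : smooth_section_at x (e i) by exact: se.
have sG i j : smooth_at x (fun y => G y i j).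
  have -> : (fun y => G y i j) = (fun y => g y (e i y) (e j y)).
    by apply/funext => y; rewrite mxE.
  exact: bil_smooth.
have sc i : smooth_at x (c i).
  apply: smooth_atM.
    by apply: (smooth_at_inv oW Wx) => //; exact: smooth_at_det.
  apply: smooth_at_sum => j; apply: smooth_atM; first exact: bil_smooth.
  exact: smooth_at_adj.
have sS : smooth_at x (fun y => \sum_i c i y * e i y f).
  by apply: smooth_at_sum => i; apply: smooth_atM => //; exact: sg.
apply: (smooth_at_eq oW Wx _ sS) => y Wy /=.
by rewrite PE // tangent_sumE.
Qed.

End TensorAlgebra.

(** * The additive group of vector fields *)

Section VectorFieldModule.
Local Open Scope ring_scope.
Context {R : realType} {m : nat} {M : smooth_manifold R m}.

(** Classical equality and choice are the prerequisites of the Zmodule structure, which gives access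
    to subtraction and finite sums of vector fields. *)
HB.instance Definition _ := gen_eqMixin (vector_field M).
HB.instance Definition _ := gen_choiceMixin (vector_field M).

Lemma vf_zero_smooth (x : M) :
  smooth_section_at x (fun y => 0 : tangent y).
Proof. by move=> f _; exact: smooth_at_cst. Qed.

Lemma vf_opp_smooth (X : vector_field M) x :
  smooth_section_at x (fun y => - X y).
Proof.
move=> f sf.
have -> : (fun y => (- X y) f) = (fun y => -1 * X y f).
  by apply/funext => y; rewrite -scaleN1r.
by apply: smooth_atM; [exact: smooth_at_cst|exact: vf_smooth].
Qed.

Lemma vf_addA : associative (@vf_add R m M).
Proof. by move=> X Y Z; apply: vector_field_ext => x /=; rewrite addrA. Qed.

Lemma vf_addC : commutative (@vf_add R m M).
Proof. by move=> X Y; apply: vector_field_ext => x /=; rewrite addrC. Qed.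

Lemma vf_add0 : left_id (VectorField vf_zero_smooth) (@vf_add R m M).
Proof. by move=> X; apply: vector_field_ext => x /=; rewrite add0r. Qed.

Lemma vf_addN : left_inverse (VectorField vf_zero_smooth)
  (fun X => VectorField (vf_opp_smooth X)) (@vf_add R m M).
Proof. by move=> X; apply: vector_field_ext => x /=; rewrite addNr. Qed.

HB.instance Definition _ := GRing.isZmodule.Build (vector_field M)
  vf_addA vf_addC vf_add0 vf_addN.

Implicit Types (X Y V : vector_field M) (N : connection M).

Lemma vf_sumE (I : Type) (s : seq I) (P : pred I) (F : I -> vector_field M) x :
  (\sum_(i <- s | P i) F i) x = \sum_(i <- s | P i) F i x.
Proof. exact: (big_morph (fun X : vector_field M => X x)). Qed.

Lemma nabla_addl N V V' X : N (V + V') X = N V X + N V' X.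
Proof. exact: nablaDl. Qed.

Lemma nabla_addr N V X Y : N V (X + Y) = N V X + N V Y.
Proof. exact: nablaDr. Qed.

Lemma nabla0 N V : N V 0 = 0.
Proof. by apply: (addrI (N V 0)); rewrite -nabla_addr !addr0. Qed.

Lemma nablaN N V X : N V (- X) = - N V X.
Proof. by apply: (addrI (N V X)); rewrite -nabla_addr !subrr nabla0. Qed.

Lemma nabla_sum N V (I : Type) (s : seq I) (P : pred I)
    (F : I -> vector_field M) :
  N V (\sum_(i <- s | P i) F i) = \sum_(i <- s | P i) N V (F i).
Proof. by apply: big_morph; [exact: nabla_addr|exact: nabla0]. Qed.

Lemma connection_ext N N' : (forall X Y, N X Y = N' X Y) -> N = N'.
Proof.
case: N N' => [N a b c d] [N' a' b' c' d'] /= E.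
have {}E : N = N' by apply/funext => X; apply/funext => Y; exact: E.
by subst N'; congr Connection; exact: Prop_irrelevance.
Qed.

End VectorFieldModule.

(** * Covariant derivatives of bilinear forms *)

Section CovariantDerivative.
Local Open Scope ring_scope.
Context {R : realType} {m : nat} {M : smooth_manifold R m}.
Implicit Types (X Y Z V : vector_field M) (N : connection M).
Implicit Types (b w g : bilinear_field M).

Lemma bil_smooth_vf b X Y x : smooth_at x (fun y => b y (X y) (Y y)).
Proof. by apply: bil_smooth; exact: vf_smooth. Qed.

(** This is (nabla_V b)(X, Y) at x, kept as a function of vector fields: the splittings below rely
    on its additivity. *)
Definition cov2 N b V X Y x : R :=
  V x (fun y => b y (X y) (Y y)) - b x (N V X x) (Y x) - b x (X x) (N V Y x).

Lemma parallelP N b : parallel N b <-> forall V X Y x, cov2 N b V X Y x = 0.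
Proof.
by rewrite /cov2; split=> H V X Y x; have := H V X Y x; lra.
Qed.

Lemma cov2Dl N b V V' X Y x :
  cov2 N b (V + V') X Y x = cov2 N b V X Y x + cov2 N b V' X Y x.
Proof.
rewrite /cov2 !nabla_addl.
rewrite -[(V + V') x _]/(V x (fun y => b y (X y) (Y y)) +
  V' x (fun y => b y (X y) (Y y))).
by rewrite bilDl bilDr; ring.
Qed.

Lemma cov2Dm N b V X X' Y x :
  cov2 N b V (X + X') Y x = cov2 N b V X Y x + cov2 N b V X' Y x.
Proof.
rewrite /cov2 !nabla_addr /= !bilDl.
have -> : (fun y => b y ((X + X') y) (Y y)) =
    (fun y => b y (X y) (Y y) + b y (X' y) (Y y)).
  by apply/funext => y; rewrite /= bilDl.
by rewrite tangentD; [ring|exact: bil_smooth_vf..].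
Qed.

Lemma two_form_skew w x (u v : tangent x) : two_form w ->
  w x u v = - w x v u.
Proof.
move=> w2; have := w2 x (u + v); rewrite bilDl !bilDr !w2; lra.
Qed.

Lemma cov2_skew N w V X Y x : two_form w ->
  cov2 N w V X Y x = - cov2 N w V Y X x.
Proof.
move=> w2; rewrite /cov2.
have -> : (fun y => w y (X y) (Y y)) = (fun y => - w y (Y y) (X y)).
  by apply/funext => y; exact: two_form_skew.
rewrite tangentN; last exact: bil_smooth_vf.
rewrite (two_form_skew (N V X x)) // (two_form_skew (X x)) //; ring.
Qed.

Lemma bracket_nabla N : (forall X Y x, torsion N X Y x = 0) ->
  forall X Y x, bracket X Y x = N X Y x - N Y X x.
Proof.
by move=> tor X Y x; have /eqP := tor X Y x; rewrite subr_eq0 => /eqP.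
Qed.

(** For a torsion-free connection the cyclic sum of nabla w is dw: the brackets in [ext_deriv2]
    become differences of covariant derivatives. *)
Lemma cov2_cyclic N w X Y Z x : two_form w -> closed_form w ->
  (forall X Y x, torsion N X Y x = 0) ->
  cov2 N w X Y Z x + cov2 N w Y Z X x + cov2 N w Z X Y x = 0.
Proof.
move=> w2 wc tor.
have := wc X Y Z x.
rewrite /ext_deriv2 !(bracket_nabla tor) !bilDl !bilNl /cov2.
have -> : (fun y => w y (X y) (Z y)) = (fun y => - w y (Z y) (X y)).
  by apply/funext => y; exact: two_form_skew.
rewrite tangentN; last exact: bil_smooth_vf.
rewrite (two_form_skew (Y x)) // (two_form_skew (Z x)) //.
rewrite (two_form_skew (X x)) //.
lra.
Qed.

End CovariantDerivative.

(** * Kaehler identities for a partial complex structure *)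

(* J is only a partial complex structure: J^3 = - J, so that TM is the direct
   sum of ker J and of the image of J, on which J^2 = - 1. *)
Section PartialKahler.
Local Open Scope ring_scope.
Context {R : realType} {m : nat} {M : smooth_manifold R m}.
Context {w g : bilinear_field M} {J : endo_field M} {N : connection M}.
Context (gm : riemannian_metric g) (lc : levi_civita g N).
Context (w2 : two_form w) (wc : closed_form w).
Context (wE : forall x (u v : tangent x), w x u v = g x u (J x v)).
Context (J3 : forall x (v : tangent x), J x (J x (J x v)) = - J x v).
Implicit Types (X Y Z V : vector_field M).

Lemma metric_skew x (u v : tangent x) : g x (J x u) v = - g x u (J x v).
Proof.
by have [gs _] := gm; rewrite gs -!wE; exact: two_form_skew.
Qed.

(** Because nabla g = 0, the derivative of w = g(., J .) only sees J: this is g(X, (nabla_V J)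
    Y). *)
Lemma cov2_endo V X Y x :
  cov2 N w V X Y x = g x (X x) (N V (endo_app J Y) x - J x (N V Y x)).
Proof.
have [par _] := lc; rewrite /cov2 !wE.
under [X in V x X]eq_fun do rewrite wE.
by have /= -> := par V X (endo_app J Y) x; rewrite bilDr bilNr; ring.
Qed.

(** By [J3] this describes the fields with values in the image of J: every J X satisfies it, and
    conversely X = J (- J X). *)
Definition in_image X := endo_app J (endo_app J X) = - X.

(** Differentiating J^2 Y = - Y makes nabla J anticommute with J when paired with X, and J is skew
    for g; the two signs cancel. *)
Lemma cov2_endo_swap V X Y x : in_image X -> in_image Y ->
  cov2 N w V (endo_app J X) Y x = cov2 N w V X (endo_app J Y) x.
Proof.
move=> iX iY; rewrite !cov2_endo iY nablaN /= metric_skew.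
have JJX : J x (J x (X x)) = - X x by rewrite -[RHS]/((- X) x) -iX.
(* Moving J twice across g and using J^2 X = - X, the operator J^2 acts as -1 when paired with X. *)
have H : g x (X x) (J x (J x (N V Y x))) = - g x (X x) (N V Y x).
  have := metric_skew (X x) (J x (N V Y x)).
  have := metric_skew (J x (X x)) (N V Y x); rewrite JJX bilNl.
  lra.
by rewrite endoD endoN !bilDr !bilNr H; ring.
Qed.

Lemma cov2_in_image X Y Z x :
  (forall X Y, in_image X -> in_image Y -> forall x, nijenhuis J X Y x = 0) ->
  in_image X -> in_image Y -> in_image Z -> cov2 N w X Y Z x = 0.
Proof.
move=> nij iX iY iZ; have [par tor] := lc.
have iJ U : in_image U -> in_image (endo_app J U).
  by move=> iU; apply: vector_field_ext => y /=; rewrite J3.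
(* The pairing of W with the Nijenhuis tensor of U, V equals -2 (nabla_W w)(V, J U). *)
have key U V W : in_image U -> in_image V -> in_image W ->
    cov2 N w W V (endo_app J U) x = 0.
  move=> iU iV iW.
  have : g x (W x) (nijenhuis J U V x) = 0 by rewrite nij // bil0r.
  rewrite /nijenhuis !(bracket_nabla tor) !endoD !endoN.
  (* The pairing consists of the four terms [E1] to [E4]. The cyclic identities remove the
     derivatives along J U and J V; swapping J and skewness then cancel those along U and V, leaving
     only derivatives along W. *)
  have C1 := @cov2_cyclic _ _ _ N w (endo_app J U) W V x w2 wc tor.
  have C2 := @cov2_cyclic _ _ _ N w (endo_app J V) W U x w2 wc tor.
  have E1 := cov2_endo (endo_app J U) W V x.
  have E2 := cov2_endo (endo_app J V) W U x.
  have E3 := cov2_endo U (endo_app J W) V x.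
  have E4 := cov2_endo V (endo_app J W) U x.
  have S1 := cov2_endo_swap V x iU iW.
  have S2 := cov2_endo_swap U x iV iW.
  have S3 := cov2_endo_swap W x iU iV.
  have T1 := cov2_endo_swap V x iW iU.
  have T2 := cov2_endo_swap U x iW iV.
  have K1 := @cov2_skew _ _ _ N w V (endo_app J U) W x w2.
  have K2 := @cov2_skew _ _ _ N w U (endo_app J V) W x w2.
  have K3 := @cov2_skew _ _ _ N w W V (endo_app J U) x w2.
  move: E1 E2 E3 E4; rewrite /= !metric_skew !bilDr !bilNr.
  rewrite !endoD !endoN !bilDr !bilNr => E1 E2 E3 E4 Nij.
  have K4 := @cov2_skew _ _ _ N w V (endo_app J W) U x w2.
  have K5 := @cov2_skew _ _ _ N w U (endo_app J W) V x w2.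
  lra.
have iNJ : in_image (- endo_app J Z).
  by apply: vector_field_ext => y /=; rewrite !endoN J3.
have -> : Z = endo_app J (- endo_app J Z).
  apply: vector_field_ext => y /=; rewrite endoN.
  by rewrite -[J y _]/(endo_app J (endo_app J Z) y) iZ /= opprK.
exact: key.
Qed.

Lemma parallel_of_kernel :
  (forall X Y, in_image X -> in_image Y -> forall x, nijenhuis J X Y x = 0) ->
  preserves N (fun x v => J x v = 0) -> parallel N w.
Proof.
move=> nij preK; have [_ tor] := lc.
(* w vanishes as soon as one argument is in ker J, and N keeps X there, so each of the three terms
   of [cov2] is zero. *)
have kerl V X Y x : (forall y, J y (X y) = 0) -> cov2 N w V X Y x = 0.
  move=> JX; have w0 y (u v : tangent y) : J y u = 0 -> w y u v = 0.
    by move=> Ju; rewrite two_form_skew // wE Ju bil0r oppr0.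
  rewrite /cov2 (w0 x (N V X x)); last exact: preK.
  rewrite (w0 x (X x)) // !subr0.
  have -> : (fun y => w y (X y) (Y y)) = (fun=> 0).
    by apply/funext => y; exact: w0.
  exact: tangent0.
have kerr V X Y x : (forall y, J y (Y y) = 0) -> cov2 N w V X Y x = 0.
  by move=> JY; rewrite cov2_skew // kerl // oppr0.
(* Since J^3 = - J, the projections onto the image and the kernel of J are - J^2 and 1 + J^2. *)
pose im X := - endo_app J (endo_app J X).
pose ker X := X + endo_app J (endo_app J X).
have splitE X : X = im X + ker X.
  by rewrite /im /ker addrCA addNr addr0.
have imP X : in_image (im X).
  by apply: vector_field_ext => y /=; rewrite !endoN J3.
have kerP X y : J y (ker X y) = 0 by rewrite /= endoD J3 subrr.
apply/parallelP => V X Y x.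
rewrite [X]splitE cov2Dm (kerl _ (ker X)); last exact: kerP.
rewrite addr0 cov2_skew // [Y]splitE cov2Dm (kerl _ (ker Y)); last exact: kerP.
rewrite addr0 [V]splitE cov2Dl cov2_in_image // add0r.
(* In the cyclic sum the two other terms have [ker V] as an argument of w, so they vanish. *)
have := @cov2_cyclic _ _ _ N w (ker V) (im Y) (im X) x w2 wc tor.
rewrite (kerr (im Y)); last exact: kerP.
rewrite (kerl (im X)); last exact: kerP.
by rewrite !addr0 => ->; rewrite oppr0.
Qed.

Lemma parallel_endo V X x : parallel N w ->
  N V (endo_app J X) x = J x (N V X x).
Proof.
move=> /parallelP pw.
apply/eqP; rewrite -subr_eq0; apply/eqP/(metric_eq0 gm).
(* With Y the defect itself, [cov2_endo] turns (nabla_V w)(Y, X) into g(Y, Y). *)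
pose Y := N V (endo_app J X) - endo_app J (N V X).
by have := pw V Y X x; rewrite cov2_endo.
Qed.

End PartialKahler.

(** * Pointwise relations between L, the L_a, Q and the J_a *)

Section AlmostKKahler.
Local Open Scope classical_set_scope.
Local Open Scope ring_scope.

Lemma distribution_submod (R : realType) m (M : smooth_manifold R m) d
    (D : subspace_field M) x c (u v : tangent x) :
  Defs.distribution d D -> D x u -> D x v -> D x (c *: u + v).
Proof.
move=> /(_ x)[W [e [_ Wx _ _ /(_ x Wx) ->]]] [a ->] [b ->].
exists (fun i => c * a i + b i).
rewrite scaler_sumr -big_split; apply: eq_bigr => i _ /=.
by rewrite scalerDl scalerA.
Qed.

Context {R : realType} {n k : nat} {M : smooth_manifold R (n * k.+1)}.
Context {w : 'I_k -> bilinear_field M} {L Q : subspace_field M}.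
Arguments L : clear implicits.
Arguments Q : clear implicits.
Context {J : 'I_k -> endo_field M} {g : bilinear_field M}.
Context (hk : (0 < k)%N).
Context (hS : k_symplectic w L) (hT : Defs.transversal w L Q).
Context (hA : almost_k_kahler w L Q J g).
Implicit Types (a b : 'I_k) (x y : M) (X Y V : vector_field M).

Let w2 a : two_form (w a). Proof. by have [/(_ a)[]] := hS. Qed.
Let wL a x (u v : tangent x) : L x u -> L x v -> w a x u v = 0.
Proof. by have [_ _ _] := hS; exact. Qed.
Let wQ a x (u v : tangent x) : Q x u -> Q x v -> w a x u v = 0.
Proof. by have [_ + _ _] := hT; exact. Qed.
Let wE := akk_compat hA.
Let gm := akk_metric hA.
Let gsym x (u v : tangent x) : g x u v = g x v u.
Proof. by have [+ _] := gm; exact. Qed.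
Let ldist : Defs.distribution (n * k) L. Proof. by have [_ []] := hS. Qed.
Let qdist : Defs.distribution n Q. Proof. by have [[[]]] := hT. Qed.

Lemma tangent_split x (v : tangent x) :
  exists l q, [/\ L x l, Q x q & v = l + q].
Proof.
have [[_ /(_ x)[_ sE]] _ _ _] := hT.
have : dsum L Q x v by rewrite sE.
by move=> [l Ll [q Qq <-]]; exists l, q.
Qed.

Lemma L_Q_eq0 x (v : tangent x) : L x v -> Q x v -> v = 0.
Proof.
have [[_ /(_ x)[iE _]] _ _ _] := hT => Lv Qv.
by have : (L x `&` Q x) v by []; rewrite iE.
Qed.

Lemma L_lin x c (u v : tangent x) : L x u -> L x v -> L x (c *: u + v).
Proof. exact: (distribution_submod _ ldist). Qed.

Lemma Q_lin x c (u v : tangent x) : Q x u -> Q x v -> Q x (c *: u + v).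
Proof. exact: (distribution_submod _ qdist). Qed.

Lemma L_sub x (u v : tangent x) : L x u -> L x v -> L x (u - v).
Proof. by move=> Lu Lv; rewrite addrC -scaleN1r; exact: L_lin. Qed.

Lemma Q_sub x (u v : tangent x) : Q x u -> Q x v -> Q x (u - v).
Proof. by move=> Qu Qv; rewrite addrC -scaleN1r; exact: Q_lin. Qed.

Lemma Q0 x : Q x 0.
Proof.
have [_ [q [_ Qq _]]] := tangent_split (0 : tangent x).
by rewrite -(subrr q); exact: Q_sub.
Qed.

Lemma L0 x : L x 0.
Proof.
have [l [_ [Ll _ _]]] := tangent_split (0 : tangent x).
by rewrite -(subrr l); exact: L_sub.
Qed.

Lemma J_Q a x (v : tangent x) : Q x v -> Lsub w L a x (J a x v).
Proof. by move=> Qv; rewrite -(akk_JQ hA); exists v. Qed.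

Lemma J_Lsub a x (v : tangent x) : Lsub w L a x v -> Q x (J a x v).
Proof. by move=> Lv; rewrite -(akk_JL hA a); exists v. Qed.

Lemma Lsub_sub a x (u v : tangent x) :
  Lsub w L a x u -> Lsub w L a x v -> Lsub w L a x (u - v).
Proof.
rewrite -!(akk_JQ hA) => -[p Qp <-] [q Qq <-].
by exists (p - q); [exact: Q_sub|rewrite endoD endoN].
Qed.

Lemma J2_Lsub a x (v : tangent x) : Lsub w L a x v -> J a x (J a x v) = - v.
Proof.
move=> Lv; apply: (akk_Jsq hA); exists v => //; exists 0; first exact: Q0.
by rewrite addr0.
Qed.

Lemma J2_Q a x (v : tangent x) : Q x v -> J a x (J a x v) = - v.
Proof.
move=> Qv; apply: (akk_Jsq hA); exists 0.
  by rewrite -[0](endo0 (J a)); apply: J_Q; exact: Q0.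
by exists v => //; rewrite add0r.
Qed.

(** For k different from 1, write v = l + q. As each w_b vanishes on L and on Q, the component q is
    in every kernel defining L_a too; but L_a and Q are orthogonal, so q = 0. *)
Lemma Lsub_L a x (v : tangent x) : Lsub w L a x v -> L x v.
Proof.
move=> Lav; have [l [q [Ll Qq vE]]] := tangent_split v.
move: (Lav); rewrite {1}/Lsub; case: ifPn => // k1 Lav'.
have Laq : Lsub w L a x q.
  rewrite /Lsub (negPf k1) => b ba u.
  have [l' [q' [Ll' Qq' ->]]] := tangent_split u.
  have := Lav' b ba l'; rewrite vE bilDl wL // add0r => H.
  by rewrite bilDr H wQ // addr0.
have q0 : q = 0 by apply: (metric_eq0 gm); exact: (akk_orthLQ hA) Laq Qq.
by rewrite vE q0 addr0.
Qed.

(** For any index a, g(u, v) = - w_a(u, J_a v), and both u and J_a v lie in L, where w_a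
    vanishes. *)
Lemma orth_L_Q x (u v : tangent x) : L x u -> Q x v -> g x u v = 0.
Proof.
move=> Lu Qv; pose a := Ordinal hk.
rewrite -[v]opprK -(J2_Q a Qv) bilNr -wE wL ?oppr0 //.
by apply/Lsub_L/J_Q.
Qed.

(** If l is the L-component of J_a v, then g(l, l) = g(l, J_a v) = w_a(l, v) = 0. *)
Lemma J_L a x (v : tangent x) : L x v -> Q x (J a x v).
Proof.
move=> Lv; have [l [q [Ll Qq JE]]] := tangent_split (J a x v).
suff l0 : l = 0 by rewrite JE l0 add0r.
apply: (metric_eq0 gm); have := wL a Ll Lv.
by rewrite wE JE bilDr (orth_L_Q Ll Qq) addr0.
Qed.

Lemma J_cube a x (v : tangent x) : J a x (J a x (J a x v)) = - J a x v.
Proof.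
have [l [q [Ll Qq ->]]] := tangent_split v.
by rewrite !endoD opprD (J2_Q _ (J_L a Ll)) (J2_Lsub (J_Q a Qq)).
Qed.

(** The L_b-component of v is - J_b^2 v: the remainder is killed by every J_a, hence lies in the
    common kernel of the w_a, which is zero. This replaces a dimension count for L being the sum of
    the L_b. *)
Lemma L_sum x (v : tangent x) : L x v -> v = - \sum_b J b x (J b x v).
Proof.
move=> Lv; apply/eqP; rewrite -subr_eq0 opprK; apply/eqP.
set p := v + _; have Jp a : J a x p = 0.
  rewrite endoD endo_sum (bigD1 a) //= J_cube big1 ?addr0 ?subrr // => b ba.
  by apply: (akk_J0 hA ba); apply/J_Q/J_L.
have : (\bigcap_(a in [set: 'I_k]) char_space (w a) x) p.
  by move=> a _ u; rewrite two_form_skew // wE Jp bil0r oppr0.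
by have [_ _ -> _] := hS.
Qed.

(** For v = l + q, the vector J_a q = - J_a l is both in L_a and in Q, hence zero, and J_a is
    injective on Q. *)
Lemma ker_J_L a x (v : tangent x) : J a x v = 0 -> L x v.
Proof.
have [l [q [Ll Qq ->]]] := tangent_split v; rewrite endoD => E.
suff Jq : J a x q = 0.
  have -> : q = 0 by rewrite -[q]opprK -(J2_Q a Qq) Jq endo0 oppr0.
  by rewrite addr0.
apply: L_Q_eq0; first exact/Lsub_L/J_Q.
have -> : J a x q = 0 - J a x l by rewrite -E addrC addrA addNr add0r.
by apply: Q_sub; [exact: Q0|exact: J_L].
Qed.

(** If J_a Z = l + q, then Z = J_a (- q) + J_a (- l), with summands in L_a and Q. *)
Lemma nijenhuis_in_image a X Y :
  (forall X Y, section_of (dsum (Lsub w L a) Q) X ->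
     section_of (dsum (Lsub w L a) Q) Y ->
     forall x, nijenhuis (J a) X Y x = 0) ->
  in_image (J := J a) X -> in_image (J := J a) Y ->
  forall x, nijenhuis (J a) X Y x = 0.
Proof.
move=> nij; have H Z : in_image (J := J a) Z ->
    section_of (dsum (Lsub w L a) Q) Z.
  move=> iZ x; have [l [q [Ll Qq JE]]] := tangent_split (J a x (Z x)).
  have -> : Z x = J a x (- q) + J a x (- l).
    rewrite -endoD -opprD [q + l]addrC -JE endoN.
    by rewrite -[J a x (J a x _)]/(endo_app _ (endo_app _ Z) x) iZ /= opprK.
  exists (J a x (- q)); first by rewrite -[- q]add0r; apply/J_Q/Q_sub/Qq/Q0.
  exists (J a x (- l)) => //.
  by rewrite -[- l]add0r; apply/J_L/L_sub/Ll/L0.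
by move=> /H sX /H sY; exact: nij.
Qed.

(** * Connections that preserve every L_a *)

Section Preserving.
Context {N : connection M} (pN : forall a, preserves N (Lsub w L a)).

Lemma nabla_L_sum V X x : section_of L X ->
  N V X x = - \sum_b N V (endo_app (J b) (endo_app (J b) X)) x.
Proof.
move=> LX.
have XE : X = - \sum_b endo_app (J b) (endo_app (J b) X).
  apply: vector_field_ext => y; rewrite {1}[X y]L_sum //.
  by rewrite -[RHS]/(- (\sum_b _ : vector_field M) y) vf_sumE.
rewrite {1}XE nablaN nabla_sum.
by rewrite -[LHS]/(- (\sum_b _ : vector_field M) x) vf_sumE.
Qed.

Lemma section_J2 b X : section_of L X ->
  section_of (Lsub w L b) (endo_app (J b) (endo_app (J b) X)).
Proof. by move=> LX y; apply/J_Q/J_L/LX. Qed.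

Lemma preserves_L : preserves N L.
Proof.
move=> V X LX x; rewrite nabla_L_sum // -sub0r; apply: L_sub; first exact: L0.
elim/big_ind: _ => [|u v Lu Lv|b _]; first exact: L0.
  by rewrite -[u]scale1r; exact: L_lin.
by apply: (@Lsub_L b); apply: pN; exact: section_J2.
Qed.

(** A field in ker J_a lies in L and has no L_a-component; its other components stay in L_b with b
    different from a, where J_a vanishes. *)
Lemma preserves_ker_J a : preserves N (fun x v => J a x v = 0).
Proof.
move=> V X JX x; have LX : section_of L X by move=> y; exact: (@ker_J_L a).
rewrite nabla_L_sum // endoN endo_sum big1 ?oppr0 // => b _.
have [->|ba] := eqVneq b a; last first.
  by apply: (akk_J0 hA ba); apply: pN; exact: section_J2.
have -> : endo_app (J a) (endo_app (J a) X) = 0.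
  by apply: vector_field_ext => y /=; rewrite JX endo0.
by rewrite nabla0 endo0.
Qed.

End Preserving.

(** * Global splitting along L + Q and uniqueness of the canonical connection *)

Lemma section_split X : exists Y Z : vector_field M,
  [/\ section_of L Y, section_of Q Z & X = Y + Z].
Proof.
have H y (v : tangent y) : exists l, L y l /\ Q y (v - l).
  have [l [q [Ll Qq ->]]] := tangent_split v.
  by exists l; split=> //; rewrite addrC addKr.
(* The L-component is chosen pointwise; as L and Q are orthogonal, it is the orthogonal projection,
   hence smooth. *)
pose P y v := sval (cid (H y v)).
have PL y v : L y (P y v) by rewrite /P; case: cid => l [].
have PQ y v : Q y (v - P y v) by rewrite /P; case: cid => l [].
have sP x : smooth_section_at x (fun y => P y (X y)).
  apply: (orth_proj_smooth ldist gm PL) => [y u v Lu|]; last exact: vf_smooth.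
  by rewrite gsym; apply: orth_L_Q.
pose Y := VectorField sP.
exists Y, (X - Y); split=> [y|y|]; [exact: PL|exact: PQ|].
by rewrite addrC subrK.
Qed.

(** Here w_a(v, J_a v) = - g(v, v), so the single test vector J_a v detects whether v vanishes. *)
Lemma w_J_eq0 a x (v : tangent x) : J a x (J a x v) = - v ->
  w a x v (J a x v) = 0 -> v = 0.
Proof.
move=> JJ; rewrite wE JJ bilNr => /eqP; rewrite oppr_eq0 => /eqP.
exact: (metric_eq0 gm).
Qed.

Lemma canonical_connection_unique N N' :
  canonical_connection w L Q N -> canonical_connection w L Q N' -> N = N'.
Proof.
move=> [pL pQ par tor] [pL' pQ' par' tor'].
have mixed X Y : section_of L X -> section_of Q Y ->
    N X Y = N' X Y /\ N Y X = N' Y X.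
  move=> LX QY.
  (* Both connections satisfy nabla_X Y - nabla_Y X = [X, Y]. Their differences on (X, Y) and (Y, X)
     therefore agree, one lying in Q and the other in L. *)
  have E x : N X Y x - N' X Y x = N Y X x - N' Y X x.
    have := etrans (tor X Y LX QY x) (esym (tor' X Y LX QY x)).
    rewrite /torsion => /addIr /eqP.
    rewrite subr_eq => /eqP ->.
    by rewrite [N' X Y x - _]addrC addrAC addrK addrC.
  have Z x : N Y X x - N' Y X x = 0.
    apply: L_Q_eq0; first by apply: L_sub; exact: preserves_L.
    by rewrite -E; apply: Q_sub; [exact: pQ|exact: pQ'].
  by split; apply: vector_field_ext => x; apply/eqP;
    rewrite -subr_eq0 ?E Z.
have same a V X Y x : N V Y = N' V Y ->
    w a x ((N V X - N' V X) x) (Y x) = 0.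
  move=> E; have := par a V X Y x; rewrite par' E.
  rewrite -[(N V X - _) x]/(N V X x - N' V X x) bilDl bilNl; lra.
have onLsub a X X' : section_of L X -> section_of (Lsub w L a) X' ->
    N X X' = N' X X'.
  move=> LX LX'; pose d := N X X' - N' X X'.
  (* The difference d stays in L_a, so the test field J_a d is in Q, where [mixed] applies. *)
  have Ld y : Lsub w L a y (d y).
    by apply: Lsub_sub; [exact: pL|exact: pL'].
  apply/eqP; rewrite -subr_eq0; apply/eqP/vector_field_ext => x.
  apply: (@w_J_eq0 a x (d x)); first exact: J2_Lsub.
  apply: (same a X X' (endo_app (J a) d)).
  by have [] := @mixed X (endo_app (J a) d) LX (fun y => J_Lsub (Ld y)).
have onL X X' : section_of L X -> section_of L X' -> N X X' = N' X X'.
  move=> LX LX'; apply: vector_field_ext => x; rewrite !nabla_L_sum //.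
  congr (- _); apply: eq_bigr => b _.
  by rewrite (@onLsub b) //; exact: section_J2.
have onQ Y Y' : section_of Q Y -> section_of Q Y' -> N Y Y' = N' Y Y'.
  move=> QY QY'; pose d := N Y Y' - N' Y Y'; pose a := Ordinal hk.
  (* Dually, d stays in Q and J_a d is in L for any index a; the second half of [mixed] applies. *)
  have Qd y : Q y (d y) by apply: Q_sub; [exact: pQ|exact: pQ'].
  apply/eqP; rewrite -subr_eq0; apply/eqP/vector_field_ext => x.
  apply: (@w_J_eq0 a x (d x)); first exact: J2_Q.
  apply: (same a Y Y' (endo_app (J a) d)).
  by have [] := @mixed (endo_app (J a) d) Y
    (fun y => Lsub_L (J_Q a (Qd y))) QY.
apply: connection_ext => X Y.
have [XL [XQ [LX QX ->]]] := section_split X.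
have [YL [YQ [LY QY ->]]] := section_split Y.
rewrite !nabla_addl !nabla_addr (onL XL YL) // (onQ XQ YQ) //.
by have [-> _] := mixed _ _ LX QY; have [_ ->] := mixed _ _ LY QX.
Qed.

(** * The Levi-Civita connection preserving every L_a *)

Section LeviCivita.
Context {N : connection M} (lc : levi_civita g N).
Context (pN : forall a, preserves N (Lsub w L a)).
Context (nij : forall a X Y,
  section_of (dsum (Lsub w L a) Q) X -> section_of (dsum (Lsub w L a) Q) Y ->
  forall x, nijenhuis (J a) X Y x = 0).

Lemma levi_civita_parallel a : parallel N (w a).
Proof.
have wc : closed_form (w a) by have [/(_ a)[]] := hS.
apply: (parallel_of_kernel gm lc (w2 a) wc (wE a) (J_cube a)).
  by move=> X Y; apply: nijenhuis_in_image; exact: nij.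
exact: preserves_ker_J.
Qed.

(** For W in Q, - nabla_V W = nabla_V (J_a J_a W) = J_a nabla_V (J_a W); since J_a W is in L_a, its
    derivative stays there and J_a maps it to Q. *)
Lemma levi_civita_preserves_Q : preserves N Q.
Proof.
move=> V W QW x; pose a := Ordinal hk.
have JJW : endo_app (J a) (endo_app (J a) W) = - W.
  by apply: vector_field_ext => y; exact: J2_Q.
have E := parallel_endo gm lc (wE a) V (endo_app (J a) W) x
  (levi_civita_parallel a).
have : Q x (- N V W x).
  rewrite -[- _]/((- N V W) x) -nablaN -JJW E.
  by apply/J_Lsub/pN => y; exact: J_Q.
by move=> /(Q_sub (Q0 x)); rewrite opprK add0r.
Qed.

End LeviCivita.

End AlmostKKahler.

Theorem theorem3p7 (R : realType) (n k : nat) (hk : (0 < k)%N)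
  (M : smooth_manifold R (n * k.+1))
  (omega : 'I_k -> bilinear_field M) (L Q : subspace_field M)
  (J : 'I_k -> endo_field M) (g : bilinear_field M)
  (hM : k_kahler omega L Q J g)
  (nablag : connection M) (hg : levi_civita g nablag)
  (hL : forall a : 'I_k, preserves nablag (Lsub omega L a)) :
  preserves nablag Q /\
  unique (canonical_connection omega L Q) nablag.
Proof.
have [hS hT hA nij] := hM; have [_ tor] := hg.
have pQ := levi_civita_preserves_Q hk hS hT hA hg hL nij.
have can : canonical_connection omega L Q nablag.
  split=> // a.
  exact: (levi_civita_parallel hk hS hT hA hg hL nij).
(* What remains of [unique] is that any canonical connection equals the Levi-Civita one. *)
split=> //; split=> // N'.
exact: (canonical_connection_unique hk hS hT hA) can.
Qed.
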